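(* Let $\alpha=(\alpha_0,\ldots,\alpha_{n-1})\in Q_{n,2^n}$, and let $A$ be an $n\times n$ Boolean matrix that is domination-equivalent to the incidence matrix $M_\alpha$. If $A\mathbf{v}_n^T=\beta^T$, where $\mathbf{v}_n=(2^0,2^1,\ldots,2^{n-1})$ and the product is computed over the integers, then $\alpha$ and $\beta$ are Pascal-equivalent (where $\beta$ is regarded as an element of $Q_{n,2^n}$, i.e. as an unordered $n$-element subset of $\{0,\ldots,2^n-1\}$); equivalently, $\beta\in[\alpha]$.
   Context: $Q_{n,2^n}$ is the collection of $n$-element subsets of $\{0,1,\ldots,2^n-1\}$, whose elements may be listed as vectors $\alpha=(\alpha_0,\ldots,\alpha_{n-1})$ with distinct entries. The binary Pascal matrix $\mathbf{P}_{2^n}$ is the $2^n\times2^n$ $(0,1)$-matrix with $(\mathbf{P}_{2^n})_{i,j}\equiv\binom{i}{j}\pmod 2$, $0\le i,j\le 2^n-1$, and $\mathbf{P}_{2^n}[\alpha]$ is the $n\times n$ matrix with $(i,j)$ entry $(\mathbf{P}_{2^n})_{\alpha_i,\alpha_j}$. Two $n\times n$ matrices $M,N$ are permutation similar, $M\sim N$, if $N=Q^TMQ$ for some permutation matrix $Q$. $\alpha,\beta\in Q_{n,2^n}$ are Pascal-equivalent if $\mathbf{P}_{2^n}[\alpha]\sim\mathbf{P}_{2^n}[\beta]$ (this does not depend on the listing order); $[\alpha]$ is the Pascal-equivalence class of $\alpha$. Writing $\alpha_i=\sum_{j=0}^{n-1}b_{ij}2^j$ with $b_{ij}\in\{0,1\}$,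 the incidence matrix $M_\alpha$ is the $n\times n$ $(0,1)$-matrix with $(M_\alpha)_{i,j}=b_{ij}$. A Boolean matrix is a $(0,1)$-matrix. For row vectors, $R_i$ is dominated by $R_j$ if $R_i\le R_j$ entrywise. An $n\times n$ Boolean matrix $A$ is domination-equivalent to $M_\alpha$ if $A$ and $M_\alpha$ have identical domination relations among their rows, up to relabelling the rows: there is a permutation $\sigma$ of $\{0,\ldots,n-1\}$ such that for all $i,j$, row $i$ of $M_\alpha$ is $\le$ row $j$ of $M_\alpha$ if and only if row $\sigma(i)$ of $A$ is $\le$ row $\sigma(j)$ of $A$. *)

(* Defs.v *)
From HB Require Import structures.
From mathcomp Require Import all_boot all_order all_algebra all_fingroup.

Set Implicit Arguments.
Unset Strict Implicit.
Unset Printing Implicit Defensive.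

Import Order.TTheory GRing.Theory Num.Theory.
Local Open Scope ring_scope.

Definition Q (n : nat) : {set {set 'I_(2 ^ n)}} :=
  [set S : {set 'I_(2 ^ n)} | #|S| == n].

Definition lists (n : nat) (a : 'I_n -> 'I_(2 ^ n)) (S : {set 'I_(2 ^ n)}) :
    Prop :=
  injective a /\ S = [set a i | i : 'I_n].

Definition pascal_mx (n : nat) : 'M[int]_(2 ^ n) :=
  \matrix_(i, j) ('C(i, j) %% 2)%N%:Z.

(* P[a]; entry (i, j) of [mxsub a a P] is [P (a i) (a j)]. *)
Definition pascal_sub (n : nat) (a : 'I_n -> 'I_(2 ^ n)) : 'M[int]_n :=
  mxsub a a (pascal_mx n).

Definition perm_similar (n : nat) (M N : 'M[int]_n) : Prop :=
  exists2 P : 'M[int]_n, is_perm_mx P & N = P^T *m M *m P.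

(* The choice of listings is immaterial: see [pascal_equivP]. *)
Definition pascal_equiv (n : nat) (S T : {set 'I_(2 ^ n)}) : Prop :=
  exists a b : 'I_n -> 'I_(2 ^ n),
    [/\ lists a S, lists b T & perm_similar (pascal_sub a) (pascal_sub b)].

(* Entry (i, j) is the binary digit of weight 2 ^ j of [a i]: see
   [incidence_mxP]. *)
Definition incidence_mx (n : nat) (a : 'I_n -> 'I_(2 ^ n)) : 'M[int]_n :=
  \matrix_(i, j) (((a i : nat) %/ 2 ^ j) %% 2)%N%:Z.

Definition boolean_mx (n : nat) (A : 'M[int]_n) : Prop :=
  forall i j, A i j = 0 \/ A i j = 1.

Definition dominated (n : nat) (u v : 'rV[int]_n) : Prop :=
  forall k, u 0 k <= v 0 k.

Definition domination_equiv (n : nat) (A M : 'M[int]_n) : Prop :=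
  exists s : 'S_n, forall i j : 'I_n,
    dominated (row i M) (row j M) <-> dominated (row (s i) A) (row (s j) A).

Definition pow2_row (n : nat) : 'rV[int]_n := \row_j 2 ^+ j.

Lemma binary_expansion (n m : nat) :
  (m < 2 ^ n)%N -> (\sum_(j < n) ((m %/ 2 ^ j) %% 2) * 2 ^ j)%N = m.
Proof.
elim: n m => [|n IHn] m; first by rewrite big_ord0; case: m => [|[]].
move=> lt_m; rewrite big_ord_recl /= expn0 divn1 muln1.
rewrite (eq_bigr (fun j : 'I_n => ((m %/ 2 %/ 2 ^ j) %% 2) * 2 ^ j * 2)%N);
  last by move=> j _; rewrite /bump /= add1n expnS divnMA mulnA mulnAC.
rewrite -big_distrl /= IHn; first by rewrite addnC -divn_eq.
by rewrite ltn_divLR // mulnC -expnS.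
Qed.

Lemma incidence_mxP (n : nat) (a : 'I_n -> 'I_(2 ^ n)) :
  boolean_mx (incidence_mx a) /\
  incidence_mx a *m (pow2_row n)^T = \col_i (a i : nat)%:Z.
Proof.
split=> [i j|].
  by rewrite mxE modn2; case: odd; [right | left].
apply/matrixP=> i j; rewrite !mxE.
rewrite -[in RHS](binary_expansion (ltn_ord (a i))) -natz natr_sum.
by apply: eq_bigr => k _; rewrite !mxE natrM natrX !natz.
Qed.

Lemma perm_similarP (n : nat) (M N : 'M[int]_n) :
  perm_similar M N <-> exists s : 'S_n, forall i j, N i j = M (s i) (s j).
Proof.
have E (s : 'S_n) : (perm_mx s)^T *m M *m perm_mx s
    = \matrix_(i, j) M (s^-1%g i) (s^-1%g j).
  rewrite tr_perm_mx -row_permE.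
  rewrite -[X in _ *m perm_mx X]invgK -col_permE.
  by apply/matrixP=> i j; rewrite !mxE.
split=> [[P /is_perm_mxP [s ->] ->]|[s Hs]].
  by exists s^-1%g => i j; rewrite E mxE.
exists (perm_mx s^-1); first exact: perm_mx_is_perm.
by rewrite E; apply/matrixP=> i j; rewrite mxE invgK.
Qed.

Lemma lists_perm (n : nat) (S : {set 'I_(2 ^ n)}) (a b : 'I_n -> 'I_(2 ^ n)) :
  lists a S -> lists b S -> exists s : 'S_n, forall i, b i = a (s i).
Proof.
move=> [a_inj Sa] [b_inj Sb].
have /fin_all_exists [f Hf] i : exists j, b i = a j.
  have : b i \in S by rewrite Sb imset_f.
  by rewrite Sa => /imsetP [j _ ->]; exists j.
have f_inj : injective f by move=> i j Hij; apply: b_inj; rewrite !Hf Hij.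
by exists (perm f_inj) => i; rewrite permE.
Qed.

Lemma pascal_equivP (n : nat) (S T : {set 'I_(2 ^ n)})
    (a b : 'I_n -> 'I_(2 ^ n)) :
  lists a S -> lists b T ->
  pascal_equiv S T <-> perm_similar (pascal_sub a) (pascal_sub b).
Proof.
move=> aS bT; split=> [|ab]; last by exists a, b.
move=> [a' [b' [aS' bT' /perm_similarP [s Hs]]]].
have [u Hu] := lists_perm aS aS'; have [v Hv] := lists_perm bT' bT.
apply/perm_similarP; exists (v * s * u)%g => i j.
have := Hs (v i) (v j).
by rewrite !mxE !permM !Hu !Hv.
Qed.

(* Main.v *)
(** By Lucas' theorem modulo 2, [binom m k] is odd iff every binary digit of [k]
    is at most the corresponding digit of [m].  Hence the Pascal submatrix of a
    listing is the transposed domination relation of the rows of its incidence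
    matrix, and the permutation matching the domination relations also matches
    the Pascal submatrices.  Since distinct rows never dominate each other
    mutually, the rows of [A] are distinct and encode an [n]-element set. *)
Require Import Defs.
From mathcomp Require Import all_boot all_order all_algebra all_fingroup.

Import Order.TTheory.
Local Open Scope ring_scope.

(** One digit of Lucas' theorem modulo 2, by induction with Pascal's rule. For [m.+1] and [k.+1]
    both even, the two summands recombine by Pascal's rule at the halves; for [m.+1] even and [k.+1]
    odd they cancel modulo 2; otherwise one of them is even. *)
Lemma odd_bin_half (m k : nat) :
  odd 'C(m, k) = (odd k ==> odd m) && odd 'C(m./2, k./2).
Proof.
elim: m k => [|m IHm] [|k]; rewrite ?bin0 ?implybT //.
  by rewrite !bin0n /= uphalf_half; case: (odd k); case: (k./2).
rewrite binS oddD !IHm /= !uphalf_half.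
case: (odd m); case: (odd k) => //=; rewrite ?add0n ?add1n ?andbT ?andbF //.
- by rewrite binS oddD.
- by rewrite addbb.
- by rewrite addbF.
Qed.

Lemma odd_bin_digits (n m k : nat) : (m < 2 ^ n)%N -> (k < 2 ^ n)%N ->
  odd 'C(m, k) = [forall j : 'I_n, odd (k %/ 2 ^ j) ==> odd (m %/ 2 ^ j)].
Proof.
elim: n m k => [|n IHn] m k.
  by case: m k => [|m] [|k] // _ _; apply/esym/forallP => -[].
rewrite expnSr -!ltn_divLR // => ltm ltk.
rewrite odd_bin_half -!divn2 IHn //.
apply/andP/forallP => [[H0 /forallP H] j|H].
  case: (unliftP ord0 j) => [i ->|->]; last by rewrite expn0 !divn1.
  by rewrite /= /bump /= add1n expnS !divnMA.
split; first by have := H ord0; rewrite expn0 !divn1.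
apply/forallP => j; have := H (lift ord0 j).
by rewrite /= /bump /= add1n expnS !divnMA.
Qed.

(** Horner form, which lets inductions on the number of digits peel off the lowest one. *)
Lemma sum_digits_recl (n : nat) (d : 'I_n.+1 -> bool) :
  (\sum_(j < n.+1) d j * 2 ^ j =
   d ord0 + (\sum_(j < n) d (lift ord0 j) * 2 ^ j).*2)%N.
Proof.
rewrite big_ord_recl expn0 muln1 -muln2 big_distrl /=; congr (_ + _)%N.
by apply: eq_bigr => j _; rewrite /bump /= add1n expnSr mulnA.
Qed.

Lemma sum_digits_lt (n : nat) (d : 'I_n -> bool) :
  (\sum_(j < n) d j * 2 ^ j < 2 ^ n)%N.
Proof.
elim: n d => [|n IHn] d; first by rewrite big_ord0.
by rewrite sum_digits_recl expnSr -ltn_divLR // divn2 half_bit_double.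
Qed.

Lemma odd_sum_digits (n : nat) (d : 'I_n -> bool) (k : 'I_n) :
  odd ((\sum_(j < n) d j * 2 ^ j) %/ 2 ^ k) = d k.
Proof.
elim: n d k => [|n IHn] d k; first by case: k.
rewrite sum_digits_recl; case: (unliftP ord0 k) => [i ->|->].
  by rewrite /= /bump /= add1n expnS divnMA divn2 half_bit_double IHn.
by rewrite expn0 divn1 oddD odd_double addbF oddb.
Qed.

Lemma incidence_mxE (n : nat) (a : 'I_n -> 'I_(2 ^ n)) (i j : 'I_n) :
  incidence_mx a i j = (odd (a i %/ 2 ^ j))%:Z.
Proof. by rewrite mxE modn2. Qed.

Lemma dominated_incidenceP (n : nat) (a : 'I_n -> 'I_(2 ^ n)) (i j : 'I_n) :
  reflect (dominated (row i (incidence_mx a)) (row j (incidence_mx a)))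
          (odd 'C(a j, a i)).
Proof.
rewrite (odd_bin_digits n) //; apply: (iffP forallP) => H k; have := H k.
  by rewrite !(mxE, modn2); case: odd; case: odd.
by rewrite !(mxE, modn2); case: odd; case: odd.
Qed.

Lemma dominated_anti (n : nat) (u v : 'rV[int]_n) :
  dominated u v -> dominated v u -> u = v.
Proof.
by move=> uv vu; apply/rowP => k; apply/le_anti; rewrite uv vu.
Qed.

Lemma incidence_mx_rowP (n : nat) (a : 'I_n -> 'I_(2 ^ n)) (i j : 'I_n) :
  row i (incidence_mx a) = row j (incidence_mx a) <-> a i = a j.
Proof.
split=> [/rowP E|E]; last by apply/rowP => k; rewrite !mxE E.
apply: val_inj; rewrite /= -(binary_expansion (ltn_ord (a i))).
rewrite -[RHS](binary_expansion (ltn_ord (a j))).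
apply: eq_bigr => k _; congr (_ * _)%N.
by have := E k; rewrite !mxE => -[].
Qed.

(** Each row is read as the binary digits of a number, so [A] can be replaced by the incidence
    matrix of a family [b], not yet known to be injective. *)
Lemma boolean_mx_incidence (n : nat) (A : 'M[int]_n) :
  boolean_mx A -> exists b : 'I_n -> 'I_(2 ^ n), A = incidence_mx b.
Proof.
move=> boolA; exists (fun i => Ordinal (sum_digits_lt n (fun j => A i j == 1))).
apply/matrixP => i j; rewrite incidence_mxE odd_sum_digits.
by case: (boolA i j) => ->.
Qed.

(** Equal rows dominate each other; this transfers back along [s], where antisymmetry forces equal
    rows and hence equal values of [a]. *)
Lemma domination_equiv_inj (n : nat) (a b : 'I_n -> 'I_(2 ^ n)) :
  domination_equiv (incidence_mx b) (incidence_mx a) ->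
  injective a -> injective b.
Proof.
move=> [s Hs] a_inj i j /incidence_mx_rowP E.
apply: (perm_inj (s := s^-1%g)); apply/a_inj/incidence_mx_rowP.
by apply: dominated_anti; apply/Hs; rewrite !permKV E => k.
Qed.

Lemma domination_equiv_pascal (n : nat) (a b : 'I_n -> 'I_(2 ^ n)) :
  domination_equiv (incidence_mx b) (incidence_mx a) ->
  perm_similar (pascal_sub a) (pascal_sub b).
Proof.
move=> [s Hs]; apply/perm_similarP; exists s^-1%g => i j.
rewrite !mxE !modn2; congr (Posz (nat_of_bool _)).
(* The indices are swapped because entry [(i, j)] of a Pascal submatrix records that row [j] is
   dominated by row [i]. *)
have := Hs (s^-1%g j) (s^-1%g i); rewrite !permKV => H.
by apply/dominated_incidenceP/dominated_incidenceP => /H.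
Qed.

Theorem theorem4p2 (n : nat) (S : {set 'I_(2 ^ n)}) (alpha : 'I_n -> 'I_(2 ^ n))
    (A : 'M[int]_n) (beta : 'rV[int]_n) :
  S \in Q n ->
  lists alpha S ->
  boolean_mx A ->
  domination_equiv A (incidence_mx alpha) ->
  A *m (pow2_row n)^T = beta^T ->
  exists (T : {set 'I_(2 ^ n)}) (b : 'I_n -> 'I_(2 ^ n)),
    [/\ T \in Q n,
        lists b T,
        forall i : 'I_n, beta 0 i = (b i : nat)%:Z
      & pascal_equiv S T].
Proof.
move=> _ alphaS /boolean_mx_incidence [b ->] Hdom Hbeta.
have b_inj := domination_equiv_inj _ _ _ Hdom (proj1 alphaS).
exists [set b i | i : 'I_n], b; split=> //.
- by rewrite inE card_imset // card_ord.
- move=> i; have /matrixP/(_ i 0) := Hbeta.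
  by rewrite (proj2 (incidence_mxP b)) !mxE.
- by exists alpha, b; split=> //; apply: domination_equiv_pascal.
Qed.
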